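(* Let $p$ be a prime, $G=SL(2,\mathbb{Z}_p)$ and $T=\{F\in SL(2,\mathbb{Z}_p):\mathrm{Tr}(F)\neq 2\pmod p\}$. Then $|T|=|G|-p^2$, and the adjacency matrix of the Cayley graph $\Gamma(G,T)$ has spectrum consisting of the eigenvalues $\lambda_0=p(p^2-1)-p^2$ with multiplicity $1$, $\lambda_1=p$ with multiplicity $p(p-1)^2/2$, $\lambda_2=-1$ with multiplicity $p^2$, and $\lambda_3=-p$ with multiplicity $(p-2)(p+1)^2/2$.
   Context: The Cayley graph $\Gamma(G,T)$ of a finite group $G$ with respect to $T\subset G$ (with $I\notin T$, $T^{-1}=T$) has vertex set $G$ and an edge between $g_1$ and $g_2$ iff $g_1^{-1}g_2\in T$. Its adjacency matrix is the $|G|\times|G|$ 0/1 matrix with entry 1 exactly for adjacent pairs. Traces are taken modulo $p$. *)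

(* Defs.v *)
From HB Require Import structures.
From mathcomp Require Import all_boot all_order all_fingroup all_algebra.
From mathcomp Require Import matrix mxalgebra mxpoly zmodp.
Set Implicit Arguments. Unset Strict Implicit. Unset Printing Implicit Defensive.
Import GRing.Theory.

Definition cayley_adj (gT : finGroupType) (G T : {set gT}) : 'M[int]_#|G| :=
  \matrix_(i < #|G|, j < #|G|)
    (((@enum_val gT (mem G) i)^-1 * @enum_val gT (mem G) j)%g \in T)%:R%R.

Definition SL2 (p : nat) : {set {'GL_2['F_p]}} :=
  [set g : {'GL_2['F_p]} | (\det (GLval g) == 1)%R].

Definition Tset (p : nat) : {set {'GL_2['F_p]}} :=
  [set g in SL2 p | (\tr (GLval g) != 2%:R)%R].

(* Main.v *)
Require Import Defs.
From mathcomp Require Import all_boot all_order all_fingroup all_algebra.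
From mathcomp Require Import matrix mxalgebra mxpoly zmodp.
From mathcomp Require Import ring lra zify.
Import Order.TTheory GRing.Theory Num.Theory.
Set Implicit Arguments. Unset Strict Implicit. Unset Printing Implicit Defensive.
Local Open Scope ring_scope.

(** For g in SL(2,p), let D(g) be the number of lines of F_p^2 fixed pointwise
by g, and R(g) the number of lines stabilised by g. Since
det (g - 1) = 2 - tr g, D is p + 1 at the identity, 1 at the other elements of
trace 2, and 0 elsewhere; so, identifying functions with the corresponding
convolution matrices and writing J for the all-ones matrix, the adjacency matrix
is A = J + p - D. Counting the h in SL(2,p) with prescribed values at one or
two vectors gives
  D D = 2p D + (p + 1) J - R,  R D = (p + 1) R + (p^2 - 1) J,
whence D (D - 2p) (D - (p + 1)) = |G| J and D J = p(p + 1) J. So D is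
diagonalizable with eigenvalues among p(p + 1), 0, 2p, p + 1, both J and A are
polynomials in D, and the multiplicities follow from the traces of 1, D, D^2
and J. Working with D rather than A matters at p = 2, where two of the four
eigenvalues of A coincide. *)

(** * Spectra of polynomials in a diagonalizable matrix *)

Lemma char_poly_conj (F : fieldType) n (P A : 'M[F]_n) :
  P \in unitmx -> char_poly (invmx P *m A *m P) = char_poly A.
Proof.
move=> Pu; rewrite /char_poly.
have -> : char_poly_mx (invmx P *m A *m P) =
  map_mx polyC (invmx P) *m char_poly_mx A *m map_mx polyC P.
  rewrite /char_poly_mx mulmxBr mulmxBl !map_mxM; congr (_ - _).
  rewrite scalar_mxC -mulmxA -map_mxM mulVmx // map_mx1 mulmx1 //.
rewrite !det_mulmx mulrAC -det_mulmx -map_mxM mulVmx // map_mx1 det1 mul1r //.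
Qed.

Lemma big_image_seq (R : Type) (idx : R) (op : Monoid.com_law idx)
    (I : finType) (T : eqType) (rs : seq T) (d : I -> T) (f : T -> R) :
  uniq rs -> (forall i, d i \in rs) ->
  \big[op/idx]_i f (d i) =
  \big[op/idx]_(r <- rs) \big[op/idx]_(i | d i == r) f r.
Proof.
move=> urs drs; rewrite (exchange_big_dep xpredT) //=; apply: eq_bigr => i _.
rewrite (eq_bigl (pred1 (d i))); last by move=> r /=; rewrite eq_sym.
by rewrite -big_filter filter_pred1_uniq // big_seq1.
Qed.

(** Distinct linear factors make [A] diagonalizable, and [m r] counts the diagonal entries equal to
    [r]. One [m] serves for every [q]: traces at well-chosen [q] determine it, and a further [q]
    then yields a characteristic polynomial. *)
Lemma annihilated_spectrum (F : fieldType) n (A : 'M[F]_n.+1) (rs : seq F) :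
  uniq rs -> horner_mx A (\prod_(r <- rs) ('X - r%:P)) = 0 ->
  exists m : F -> nat, forall q,
    char_poly (horner_mx A q) = \prod_(r <- rs) ('X - q.[r]%:P) ^+ m r /\
    \tr (horner_mx A q) = \sum_(r <- rs) q.[r] *+ m r.
Proof.
move=> urs Ars.
have /diagonalizableP [P Pu] : exists2 rs, uniq rs &
  mxminpoly A %| \prod_(x <- rs) ('X - x%:P) by exists rs; rewrite ?mxminpoly_min.
move=> /diagonalizable_forPex[d /(simmxLR Pu) defA].
have hA q : horner_mx A q = invmx P *m diag_mx (map_mx (horner q) d) *m P.
  by rewrite defA conjVmx // horner_mx_uconjC // horner_mx_diag.
have drs i : d 0 i \in rs.
  have /(congr1 (fun B => P *m B *m invmx P)) := hA (\prod_(r <- rs) ('X - r%:P)).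
  rewrite Ars mulmx0 mul0mx !mulmxA mulmxV // mul1mx mulmxK //.
  move=> /matrixP/(_ i i); rewrite !mxE eqxx mulr1n => /esym/eqP.
  by rewrite -rootE root_prod_XsubC.
exists (fun r => #|[pred i | d 0 i == r]|) => q; rewrite hA; split.
  rewrite char_poly_conj // char_poly_trig ?diag_mx_is_trig //.
  transitivity (\prod_i ('X - q.[d 0 i]%:P)); first
    by apply: eq_bigr => i _; rewrite !mxE eqxx mulr1n.
  rewrite (big_image_seq _ (fun r => 'X - q.[r]%:P) urs drs).
  by apply: eq_bigr => r _; rewrite prodr_const.
rewrite mxtrace_mulC mulmxA mulmxV // mul1mx mxtrace_diag.
transitivity (\sum_i q.[d 0 i]); first by apply: eq_bigr => i _; rewrite !mxE.
rewrite (big_image_seq _ (fun r => q.[r]) urs drs).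
by apply: eq_bigr => r _; rewrite sumr_const.
Qed.

(** * Multiplicities from traces *)

Lemma char_poly_annihilated (p n : nat) (D J : 'M[rat]_n) :
  (1 < p)%N -> n = (p * (p ^ 2 - 1))%N ->
  D *m (D - (2 * p)%:R%:M) *m (D - (p + 1)%:R%:M) = n%:R *: J ->
  D *m J = (p * (p + 1))%:R *: J ->
  \tr J = n%:R -> \tr D = (n * (p + 1))%:R ->
  \tr (D *m D) = (n * (2 * p * (p + 1)))%:R ->
  char_poly (J + p%:R%:M - D) =
    (('X - ((p * (p ^ 2 - 1) - p ^ 2)%N)%:R%:P) *
     ('X - (p%:R)%:P) ^+ (p * (p - 1) ^ 2 %/ 2) *
     ('X - (-1)%:P) ^+ (p ^ 2) *
     ('X - (- p%:R)%:P) ^+ ((p - 2) * (p + 1) ^ 2 %/ 2)).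
Proof.
move=> p1 defn eD eDJ trJ trD trDD.
have p2 : (1 < p ^ 2)%N by rewrite -mulnn; nia.
have n0 : (0 < n)%N by rewrite defn muln_gt0 subn_gt0 p2 ltnW.
pose x : rat := p%:R.
have x2 : 2 <= x by rewrite (ler_nat rat 2).
have nx : n%:R = x * (x ^+ 2 - 1) :> rat.
  by rewrite defn natrM natrB ?natrX // ltnW.
case: n n0 nx {defn} D J eD eDJ trJ trD trDD => [//|n] _ nx D J eD eDJ trJ trD trDD.
have n_neq0 : n.+1%:R != 0 :> rat by rewrite pnatr_eq0.
pose f : {poly rat} := 'X * ('X - (2 * p)%:R%:P) * ('X - (p + 1)%:R%:P).
have hf : horner_mx D f = n.+1%:R *: J.
  by rewrite /f !rmorphM !rmorphB /= !horner_mx_X !horner_mx_C -eD !mulmxE.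
pose l0 : rat := x * (x + 1).
(* [l0] comes from [eDJ]; the other three are the roots of [f]. *)
pose rs := [:: l0; 0; 2 * x; x + 1].
have urs : uniq rs.
  rewrite /rs /= !inE !negb_or /l0; repeat (apply/andP; split) => //; apply/negP => /eqP; nra.
have fx r : f.[r] = r * (r - 2 * x) * (r - (x + 1)).
  by rewrite /f !hornerE natrM natrD.
have Drs : horner_mx D (\prod_(r <- rs) ('X - r%:P)) = 0.
  have -> : \prod_(r <- rs) ('X - r%:P) = ('X - l0%:P) * f.
    rewrite /rs !big_cons big_nil /f natrM natrD -/x polyC0; ring.
  rewrite rmorphM rmorphB /= horner_mx_X horner_mx_C hf.
  by rewrite -mulmxE -scalemxAr mulmxBl eDJ mul_scalar_mx natrM natrD subrr scaler0.
have [m Hm] := annihilated_spectrum urs Drs.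
have trq q : \tr (horner_mx D q) = \sum_(r <- rs) q.[r] * (m r)%:R.
  by case: (Hm q) => _ ->; apply: eq_bigr => r _; rewrite mulr_natr.
have sum_rs g : \sum_(r <- rs) g r * (m r)%:R =
    g l0 * (m l0)%:R + (g 0 * (m 0)%:R +
      (g (2 * x) * (m (2 * x))%:R + g (x + 1) * (m (x + 1))%:R)) :> rat.
  by rewrite /rs !big_cons big_nil addr0.
(* Only [l0] contributes to the trace of [f] at [D], since [f] vanishes at the other roots. As
   [f.[l0]] and this trace both equal the square of the matrix size, [l0] has multiplicity 1. *)
have h3 : x * (x ^+ 2 - 1) * (x * (x ^+ 2 - 1)) =
    (x * (x ^+ 2 - 1) * (x * (x ^+ 2 - 1))) * (m l0)%:R.
  have := trq f; rewrite sum_rs hf mxtraceZ trJ !fx nx /l0 => e; rewrite [LHS]e; ring.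
have h0 : x * (x ^+ 2 - 1) =
    (m l0)%:R + (m 0)%:R + (m (2 * x))%:R + (m (x + 1))%:R.
  have := trq 1%:P; rewrite sum_rs horner_mx_C mxtrace_scalar nx !hornerC => ->; ring.
have h1 : x * (x ^+ 2 - 1) * (x + 1) =
    l0 * (m l0)%:R + 2 * x * (m (2 * x))%:R + (x + 1) * (m (x + 1))%:R.
  have := trq 'X; rewrite sum_rs horner_mx_X trD natrM natrD nx !hornerX => ->; ring.
have h2 : x * (x ^+ 2 - 1) * (2 * x * (x + 1)) =
    l0 ^+ 2 * (m l0)%:R + 4 * x ^+ 2 * (m (2 * x))%:R + (x + 1) ^+ 2 * (m (x + 1))%:R.
  have := trq ('X * 'X); rewrite sum_rs rmorphM /= horner_mx_X.
  rewrite [X in \tr X = _](_ : _ = D *m D) // trDD !hornerM !hornerX.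
  rewrite natrM natrM natrM natrD nx => ->; ring.
have x21 : x * (x ^+ 2 - 1) != 0 by rewrite -nx.
have m0E : (m l0)%:R = 1 :> rat.
  by apply: (mulfI (mulf_neq0 x21 x21)); rewrite -h3 mulr1.
rewrite m0E /l0 in h0 h1 h2.
have x0 : x != 0 by apply: contraNneq x21 => ->; rewrite mul0r.
have xp1 : x + 1 != 0 by apply/eqP; nra.
have xm1 : x - 1 != 0 by apply/eqP; nra.
(* Subtracting [h2] from [x + 1] times [h1] eliminates [m (x + 1)]. *)
have h4 : (m (2 * x))%:R * 2 = (x - 2) * (x + 1) ^+ 2.
  apply: (mulfI (mulf_neq0 x0 xm1)).
  by have := congr1 (fun z => (x + 1) * z) h1; lra.
have h5 : (m (x + 1))%:R = x ^+ 2.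
  apply: (mulfI xp1).
  by have := congr1 (fun z => x * z) h4; lra.
have h6 : (m 0)%:R * 2 = x * (x - 1) ^+ 2 by lra.
have m2E : m (2 * x) = ((p - 2) * (p + 1) ^ 2 %/ 2)%N.
  rewrite -[LHS](mulnK _ (ltn0Sn 1)); congr (_ %/ _)%N.
  by apply/eqP; rewrite -(eqr_nat rat) (natrM _ (m _)) (natrM _ (p - 2)%N) natrX natrB // natrD h4.
have m3E : m (x + 1) = (p ^ 2)%N.
  by apply/eqP; rewrite -(eqr_nat rat) natrX h5.
have m1E : m 0 = (p * (p - 1) ^ 2 %/ 2)%N.
  rewrite -[LHS](mulnK _ (ltn0Sn 1)); congr (_ %/ _)%N.
  by apply/eqP; rewrite -(eqr_nat rat) (natrM _ (m _)) (natrM _ p) natrX natrB ?(ltnW p1) // h6.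
have m0E' : m l0 = 1%N by apply/eqP; rewrite -(eqr_nat rat) m0E.
(* [J] is [f] at [D] divided by the size, so the matrix sought is [q] at [D]; off [l0] the value of
   [q] at a root [r] is just [x - r]. *)
clearbody f; pose q : {poly rat} := n.+1%:R^-1%:P * f + x%:P - 'X.
have -> : J + x%:M - D = horner_mx D q.
  rewrite /q !(rmorphM, rmorphD, rmorphB, rmorphN) /= horner_mx_X !horner_mx_C hf.
  by rewrite -mulmxE mul_scalar_mx scalerA mulVf // scale1r.
have qx r : q.[r] = n.+1%:R^-1 * f.[r] + x - r by rewrite /q !hornerE.
rewrite (Hm q).1 /rs !big_cons big_nil m0E' m1E m2E m3E !qx !fx expr1 mulr1.
have -> : (p * (p ^ 2 - 1) - p ^ 2)%N%:R = x * (x ^+ 2 - 1) - x ^+ 2 :> rat.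
  rewrite natrB; last by rewrite -!mulnn; nia.
  by rewrite natrM natrB ?natrX // ltnW.
have -> : n.+1%:R^-1 * (l0 * (l0 - 2 * x) * (l0 - (x + 1))) + x - l0 =
   x * (x ^+ 2 - 1) - x ^+ 2.
  have -> : l0 * (l0 - 2 * x) * (l0 - (x + 1)) = n.+1%:R * n.+1%:R by rewrite nx /l0; ring.
  by rewrite mulKf // nx /l0; ring.
rewrite !(mul0r, mulr0, subrr, subr0, add0r).
have -> : x - 2 * x = - x by ring.
have -> : x - (x + 1) = -1 by ring.
by rewrite !mulrA [RHS]mulrAC.
Qed.

(** * Linear algebra in the plane *)

Lemma lift01 : lift ord0 ord0 = 1 :> 'I_2.
Proof. exact: val_inj. Qed.

(** The determinant with columns [v] and [w]; over a field it vanishes exactly when they are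
    linearly dependent. *)
Definition cross (F : comNzRingType) (v w : 'cV[F]_2) : F :=
  v 0 0 * w 1 0 - v 1 0 * w 0 0.

Lemma mul22E (F : comNzRingType) (M : 'M[F]_2) (v : 'cV[F]_2) i :
  (M *m v) i 0 = M i 0 * v 0 0 + M i 1 * v 1 0.
Proof.
by rewrite mxE !big_ord_recl big_ord0 addr0 lift01.
Qed.

Lemma cV2P (F : comNzRingType) (v w : 'cV[F]_2) :
  v 0 0 = w 0 0 -> v 1 0 = w 1 0 -> v = w.
Proof.
move=> e0 e1; apply/matrixP => i j; rewrite ord1.
case: i => [[|[|//]]] hi.
  by rewrite (_ : Ordinal hi = 0) //; apply: val_inj.
by rewrite (_ : Ordinal hi = 1) //; apply: val_inj.
Qed.

Lemma cV2_neq0 (F : comNzRingType) (v : 'cV[F]_2) :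
  v != 0 -> (v 0 0 != 0) || (v 1 0 != 0).
Proof.
apply: contra_neqT; rewrite negb_or !negbK => /andP[/eqP e0 /eqP e1].
by apply: cV2P; rewrite mxE.
Qed.

Lemma det22 (F : comNzRingType) (M : 'M[F]_2) :
  \det M = M 0 0 * M 1 1 - M 0 1 * M 1 0.
Proof.
rewrite (expand_det_row M 0) !big_ord_recl big_ord0 /cofactor !det_mx11 !mxE /=.
rewrite expr0 expr1 addr0 mul1r mulN1r mulrN !lift01.
by congr (_ - _ * M _ _); apply: val_inj.
Qed.

Lemma tr22 (F : comNzRingType) (M : 'M[F]_2) : \tr M = M 0 0 + M 1 1.
Proof.
by rewrite /mxtrace !big_ord_recl big_ord0 addr0 lift01.
Qed.

Lemma cross_mul (F : comNzRingType) (M : 'M[F]_2) v w :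
  cross (M *m v) (M *m w) = \det M * cross v w.
Proof. by rewrite /cross !mul22E det22; ring. Qed.

Lemma crossvv (F : comNzRingType) (v : 'cV[F]_2) : cross v v = 0.
Proof. by rewrite /cross mulrC subrr. Qed.

Lemma crossC (F : comNzRingType) (v w : 'cV[F]_2) : cross v w = - cross w v.
Proof. by rewrite /cross; ring. Qed.

Lemma crossZl (F : comNzRingType) c (v w : 'cV[F]_2) : cross (c *: v) w = c * cross v w.
Proof. by rewrite /cross !mxE; ring. Qed.

(** Cramer's rule: [cross v w] times [u] is [cross v u] times [w] minus [cross w u] times [v]. *)
Lemma cross_eq0_both (F : idomainType) (v w u : 'cV[F]_2) :
  cross v w != 0 -> cross v u = 0 -> cross w u = 0 -> u = 0.
Proof.
rewrite /cross => nz e1 e2; apply: cV2P; rewrite mxE; apply: (mulfI nz); rewrite mulr0.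
  transitivity (w 0 0 * (v 0 0 * u 1 0 - v 1 0 * u 0 0)
    - v 0 0 * (w 0 0 * u 1 0 - w 1 0 * u 0 0)); first by ring.
  by rewrite e1 e2 !mulr0 subrr.
transitivity (w 1 0 * (v 0 0 * u 1 0 - v 1 0 * u 0 0)
  - v 1 0 * (w 0 0 * u 1 0 - w 1 0 * u 0 0)); first by ring.
by rewrite e1 e2 !mulr0 subrr.
Qed.

Lemma cross_eq0P (F : fieldType) (v w : 'cV[F]_2) :
  w != 0 -> cross v w = 0 -> exists c, v = c *: w.
Proof.
move=> /cV2_neq0 /orP[] nz; rewrite /cross => e.
  exists (v 0 0 / w 0 0); apply: cV2P; rewrite !mxE ?mulfVK //.
  apply: (mulIf nz); rewrite mulrAC mulfVK //.
  by move/eqP: e; rewrite subr_eq0 eq_sym => /eqP.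
exists (v 1 0 / w 1 0); apply: cV2P; rewrite !mxE ?mulfVK //.
apply: (mulIf nz); rewrite mulrAC mulfVK //.
by move/eqP: e; rewrite subr_eq0 => /eqP.
Qed.

(** * Counting plane vectors *)

Section Counting.
Variable F : finFieldType.
Local Notation V := 'cV[F]_2.

(** The equation defines an affine line: a nonzero coordinate of [a] makes one coordinate of [v] a
    function of the other, which is the free parameter. *)
Lemma count_cross_eq (a : V) (c : F) : a != 0 ->
  #|[pred v | cross v a == c]| = #|F|.
Proof.
move=> /cV2_neq0 /orP[] nz.
  pose f (t : F) : V := \col_i (if i == 0 then t else (t * a 1 0 - c) / a 0 0).
  rewrite -(card_imset (f := f)); last first.
    by move=> t s /matrixP/(_ 0 0); rewrite !mxE.
  apply: eq_card => v; rewrite !inE /cross; apply/eqP/imsetP => [e|[t _ ->]].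
    exists (v 0 0) => //; apply: cV2P; rewrite !mxE //=.
    by rewrite -e opprB addrC subrK mulfK.
  by rewrite !mxE /= mulfVK // opprB addrC subrK.
pose f (t : F) : V := \col_i (if i == 0 then (c + t * a 0 0) / a 1 0 else t).
rewrite -(card_imset (f := f)); last first.
  by move=> t s /matrixP/(_ 1 0); rewrite !mxE.
apply: eq_card => v; rewrite !inE /cross; apply/eqP/imsetP => [e|[t _ ->]].
  exists (v 1 0) => //; apply: cV2P; rewrite !mxE //=.
  by rewrite -e subrK mulfK.
by rewrite !mxE /= mulfVK // addrK.
Qed.


Lemma sum_cross_eq (a : V) (c : F) : a != 0 -> (\sum_v (cross v a == c) = #|F|)%N.
Proof. by move=> a0; rewrite -(count_cross_eq c a0) -sum1_card [RHS]big_mkcond. Qed.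

Lemma card_cV2 : #|{: V}| = (#|F| ^ 2)%N.
Proof. by rewrite card_mx. Qed.

Lemma card_cross_eq0 (w : V) : w != 0 ->
  #|[pred v : V | (v != 0) && (cross v w == 0)]| = (#|F| - 1)%N.
Proof.
move=> w0; rewrite -(count_cross_eq 0 w0).
rewrite [X in (_ = X - 1)%N](cardD1 0) inE /cross !mxE !mul0r subrr eqxx add1n subn1 /=.
by apply: eq_card => v; rewrite !inE.
Qed.

Lemma card_cross_neq0 (w : V) : w != 0 ->
  #|[pred v : V | cross v w != 0]| = (#|F| ^ 2 - #|F|)%N.
Proof.
move=> w0; rewrite -card_cV2 -(count_cross_eq 0 w0).
by rewrite -(cardC [pred v : V | cross v w == 0]) addKn; apply: eq_card.
Qed.

Lemma card_neq0 : #|[pred v : V | v != 0]| = (#|F| ^ 2 - 1)%N.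
Proof.
by rewrite -card_cV2 subn1 -(cardC1 (0 : V)); apply: eq_card.
Qed.

End Counting.

Lemma sum_nat_of_bool (I : finType) (P Q : pred I) :
  (\sum_(i | P i) (Q i : nat) = #|[pred i | P i && Q i]|)%N.
Proof. by rewrite -sum1_card [RHS]big_mkcondr. Qed.

(** * Counting in SL(2,p): prescribed values, fixed vectors, eigenvectors *)

Section SL2.
Variable p : nat.
Hypothesis p_pr : prime p.
Local Notation F := 'F_p.
Local Notation V := 'cV[F]_2.
Local Notation "h • v" := ((GLval h : 'M[F]_2) *m v) (at level 35).

Lemma SL2_det h : h \in SL2 p -> \det (GLval h : 'M[F]_2) = 1.
Proof. by rewrite inE => /eqP. Qed.

Lemma mulmx_GL_inj (h : {'GL_2[F]}) : injective (mulmx (GLval h : 'M[F]_2) : V -> V).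
Proof.
move=> v w e; rewrite -[v]mul1mx -[w]mul1mx.
by rewrite -(mulVmx (GL_unitmx h)) -!mulmxA [X in _ *m X]e.
Qed.

Lemma mulmx_GL_neq0 (h : {'GL_2[F]}) (v : V) : v != 0 -> h • v != 0.
Proof. by move=> v0; rewrite -(mulmx0 _ (GLval h)) (inj_eq (@mulmx_GL_inj h)). Qed.

(** Exactly one matrix sends the basis [v], [w] to [v'], [w'], and its determinant is the quotient
    of the two cross products. *)
Lemma sum_SL2_pair (v w v' w' : V) : cross v w != 0 ->
  (\sum_(h in SL2 p) ((h • v == v') && (h • w == w')))%N
    = (cross v w == cross v' w').
Proof.
move=> nz; case: eqP => [e|ne]; last first.
  rewrite big1 // => h /SL2_det hd; apply/eqP; rewrite eqb0; apply/negP => /andP[/eqP e1 /eqP e2].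
  by apply: ne; rewrite -e1 -e2 cross_mul hd mul1r.
(* The matrix with columns [v'], [w'] times the inverse of the one with columns [v], [w], written
   through the adjugate. *)
pose M : 'M[F]_2 := \matrix_(i, j) ((cross v w)^-1 *
  (v' i 0 * (if j == 0 then w 1 0 else - w 0 0) + w' i 0 * (if j == 0 then - v 1 0 else v 0 0))).
have Mv : M *m v = v'.
  apply: cV2P; rewrite mul22E !mxE /=; apply: (mulfI nz);
    rewrite mulrDr -!mulrA !mulVKf // /cross; ring.
have Mw : M *m w = w'.
  apply: cV2P; rewrite mul22E !mxE /=; apply: (mulfI nz);
    rewrite mulrDr -!mulrA !mulVKf // /cross; ring.
have dM : \det M = 1.
  by apply: (mulIf nz); rewrite -cross_mul Mv Mw mul1r -e.
have uM : M \is a GRing.unit by rewrite -[_ \is a _]/(M \in unitmx) unitmxE dM unitr1.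
pose h0 : {'GL_2[F]} := FinRing.unit _ uM.
have h0S : h0 \in SL2 p by rewrite inE; apply/eqP.
rewrite (bigD1 h0) //= Mv Mw !eqxx big1 // => h /andP[hS /eqP hne].
apply/eqP; rewrite eqb0; apply/negP => /andP[/eqP e1 /eqP e2]; apply: hne.
apply: val_inj; apply/subr0_eq/matrixP => i j; rewrite [RHS]mxE.
pose N : 'M[F]_2 := GLval h - M.
have Nv : N *m v = 0 by rewrite mulmxBl e1 Mv subrr.
have Nw : N *m w = 0 by rewrite mulmxBl e2 Mw subrr.
(* The [i]-th row of [N] turned by a right angle, so that [cross v u] is the [i]-th entry of
   [N *m v]. *)
pose u : V := \col_k (if k == 0 then - N i 1 else N i 0).
have : u = 0.
  apply: (cross_eq0_both nz).
    by move/matrixP/(_ i 0): Nv; rewrite mul22E /cross !mxE /= => <-; ring.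
  by move/matrixP/(_ i 0): Nw; rewrite mul22E /cross !mxE /= => <-; ring.
move=> /matrixP u0; have := u0 0 0; have := u0 1 0; rewrite !mxE /= => n0 /eqP.
rewrite oppr_eq0 => /eqP n1.
case: j => [[|[|//]]] hj /=; [rewrite -[RHS]n0 | rewrite -[RHS]n1];
  by congr (GLval h i _ - _); apply: val_inj.
Qed.

Lemma card_F : #|F| = p. Proof. exact: card_Fp. Qed.

Lemma card_neq0_p : #|[pred v : V | v != 0]| = (p ^ 2 - 1)%N.
Proof. by rewrite card_neq0 card_F. Qed.

Lemma card_line (w : V) : w != 0 ->
  #|[pred v : V | (v != 0) && (cross v w == 0)]| = (p - 1)%N.
Proof. by move=> w0; rewrite card_cross_eq0 // card_F. Qed.

(** Complete [w] by some [v] with [cross v w = 1]. Then [h] is determined by the image of [v], which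
    ranges over an affine line. *)
Lemma sum_SL2_vec (w w' : V) : w != 0 -> w' != 0 ->
  (\sum_(h in SL2 p) (h • w == w'))%N = p.
Proof.
move=> w0 w'0.
have /card_gt0P[v] : (0 < #|[pred v : V | cross v w == 1%R]|)%N.
  by rewrite count_cross_eq // card_F prime_gt0.
rewrite inE => /eqP vw.
have vw0 : cross v w != 0 by rewrite vw oner_eq0.
transitivity (\sum_(h in SL2 p) \sum_(v' : V) ((h • v == v') && (h • w == w')))%N.
  apply: eq_bigr => h _; rewrite (bigD1 (h • v)) //= eqxx big1 ?addn0 // => v'.
  by rewrite eq_sym => /negbTE ->.
rewrite exchange_big /=; under eq_bigr => v' _ do rewrite sum_SL2_pair // vw eq_sym.
by rewrite sum_cross_eq // card_F.
Qed.

(** Sort the elements by the image of one nonzero vector. *)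
Lemma card_SL2 : #|SL2 p| = (p * (p ^ 2 - 1))%N.
Proof.
have /card_gt0P[w] : (0 < #|[pred w : V | w != 0%R]|)%N.
  by rewrite card_neq0 card_F subn_gt0 -{1}(exp1n 2) ltn_exp2r // prime_gt1.
rewrite inE => w0; rewrite -sum1_card.
transitivity (\sum_(h in SL2 p) \sum_(w' : V | w' != 0%R) (h • w == w'))%N.
  apply: eq_bigr => h _; rewrite (bigD1 (h • w)) ?mulmx_GL_neq0 //= eqxx big1 ?addn0 // => w'.
  by move=> /andP[_]; rewrite eq_sym => /negbTE ->.
rewrite exchange_big /=; under eq_bigr => w' w'0 do rewrite sum_SL2_vec //.
by rewrite sum_nat_const card_neq0 card_F mulnC.
Qed.

(** On SL(2,p), [fixvec] and [eigvec] are [p - 1] times the line counts D and R; counting vectors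
    keeps the double counting in [nat]. *)
Definition fixvec (M : 'M[F]_2) : nat := (\sum_(v : V | v != 0%R) (M *m v == v))%N.
Definition eigvec (M : 'M[F]_2) : nat := (\sum_(v : V | v != 0%R) (cross (M *m v) v == 0%R))%N.
Local Notation X h := (GLval h : 'M[F]_2).

Lemma sum_fixvec : (\sum_(h in SL2 p) fixvec (X h))%N = (p * (p ^ 2 - 1))%N.
Proof.
rewrite exchange_big /=; under eq_bigr => w w0 do rewrite sum_SL2_vec //.
by rewrite sum_nat_const card_neq0 card_F mulnC.
Qed.

(** Convolution with [fixvec] thus amounts to prescribing that [h] agrees with [g] at a vector. *)
Lemma fixvec_divl (h g : {'GL_2[F]}) :
  fixvec (X (h^-1 * g)%g) = (\sum_(v : V | v != 0%R) (h • v == g • v))%N.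
Proof.
apply: eq_bigr => v _; congr nat_of_bool.
rewrite -(inj_eq (@mulmx_GL_inj h)) eq_sym mulmxA GL_ME GL_VxE.
rewrite -[Y in _ == Y]/(X h *m (invmx (X h) *m X g) *m v).
by rewrite (mulKVmx (GL_unitmx h)).
Qed.

(** If [v] is parallel to [w], then [h] fixes [w], so [g] must too, and [p] elements [h] remain.
    Otherwise at most one [h] exists, and it does exactly when [cross v w = cross v (g • w)]. *)
Lemma fixvec_conv_vec (g : {'GL_2[F]}) (w : V) : w != 0 ->
  (\sum_(v : V | v != 0%R) \sum_(h in SL2 p) ((h • v == v) && (h • w == g • w)))%N =
  (2 * p * (p - 1) * (g • w == w) + (p - 1) * (cross (g • w) w != 0%R))%N.
Proof.
move=> w0; rewrite (bigID (fun v => cross v w == 0)) /=.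
have -> : (\sum_(v : V | (v != 0%R) && (cross v w == 0%R))
    \sum_(h in SL2 p) ((h • v == v) && (h • w == g • w)) = (p - 1) * (p * (g • w == w)))%N.
  rewrite -(card_line w0) -sum_nat_const; apply: eq_bigr => v /andP[v0 /eqP].
  move=> /(cross_eq0P w0) [c vE].
  have c0 : c != 0 by apply: contraNneq v0 => c0; rewrite vE c0 scale0r.
  case: eqP => [gw | gw].
    rewrite muln1 -[RHS](sum_SL2_vec w0 w0); apply: eq_bigr => h _.
    rewrite gw vE -scalemxAr; case: (h • w =P w) => [->|]; by rewrite ?eqxx ?andbF.
  rewrite muln0 big1 // => h _; apply/eqP; rewrite eqb0; apply/negP => /andP[/eqP hv /eqP hw].
  apply: gw; rewrite -hw; apply: (scalerI c0).
  by rewrite scalemxAr -vE.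
have -> : (\sum_(v : V | (v != 0%R) && (cross v w != 0%R))
    \sum_(h in SL2 p) ((h • v == v) && (h • w == g • w)) =
    #|[pred v : V | (cross v w != 0%R) && (cross v w == cross v (g • w))]|)%N.
  rewrite -sum_nat_of_bool; apply: eq_big => [v|v /andP[v0 vw]]; last by rewrite sum_SL2_pair.
  by case: (eqVneq v 0) => [->|//]; rewrite /cross !mxE !mul0r subrr eqxx.
case: (eqVneq (g • w) w) => [gw | gw].
  rewrite gw crossvv eqxx muln0 addn0 !muln1.
  rewrite (eq_card (B := [pred v : V | cross v w != 0])) ?card_cross_neq0 ?card_F //.
    by have := prime_gt0 p_pr; nia.
  by move=> v; rewrite !inE eqxx andbT.
rewrite !muln0 !add0n; have crossB v : cross v (g • w - w) = cross v (g • w) - cross v w.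
  by rewrite /cross !mxE; ring.
(* The [v] to count are parallel to [g • w - w] but not to [w]: none if [g • w] is a multiple of
   [w], otherwise all [p - 1] nonzero vectors of that line. *)
case: eqP => [gww | /eqP gww] /=.
  rewrite muln0; apply: eq_card0 => v; rewrite !inE; apply/negP => /andP[vw /eqP e].
  have [c gwE] := cross_eq0P w0 gww.
  have e' : cross v (g • w - w) = 0 by rewrite crossB e subrr.
  move: gw; rewrite -subr_eq0; apply/negP/negPn; rewrite gwE.
  move: e; rewrite gwE /cross !mxE => e.
  have -> : c = 1.
    apply: (mulIf vw); rewrite mul1r [RHS]e /cross; ring.
  by rewrite scale1r subrr.
rewrite muln1 -(card_line (w := g • w - w)) ?subr_eq0 //.
apply: eq_card => v; rewrite !inE crossB (subr_eq0 (cross v (g • w))) [Y in _ = _ && Y]eq_sym.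
case: (cross v w =P cross v (g • w)) => e; rewrite ?andbF ?andbT //.
case: (eqVneq v 0) => [->|v0]; first by rewrite /cross !mxE !mul0r subrr eqxx.
apply/eqP => vw; move/eqP: v0; apply; apply: (cross_eq0_both gww).
  by rewrite crossC -e vw oppr0.
by rewrite crossC vw oppr0.
Qed.

(* The term in [eigvec] is on the left to avoid a truncated subtraction. *)
Lemma fixvec_conv (g : {'GL_2[F]}) :
  (\sum_(h in SL2 p) fixvec (X h) * fixvec (X (h^-1 * g)%g) + (p - 1) * eigvec (X g) =
  2 * p * (p - 1) * fixvec (X g) + (p - 1) * (p ^ 2 - 1))%N.
Proof.
have -> : (\sum_(h in SL2 p) fixvec (X h) * fixvec (X (h^-1 * g)%g) =
  \sum_(w : V | w != 0%R) (2 * p * (p - 1) * (g • w == w) + (p - 1) * (cross (g • w) w != 0%R)))%N.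
  under [RHS]eq_bigr => w w0 do rewrite -fixvec_conv_vec //.
  under eq_bigr => h _.
    rewrite fixvec_divl big_distrlr exchange_big /=.
    under eq_bigr => w _ do under eq_bigr => v _ do rewrite mulnb.
    over.
  by rewrite exchange_big; apply: eq_bigr => w _; rewrite exchange_big.
rewrite big_split -!big_distrr /= -addnA -mulnDr; congr (_ + _ * _)%N.
rewrite -big_split -card_neq0_p -sum1_card; apply: eq_bigr => w _.
by case: (_ == _).
Qed.

(** If [v] is parallel to [w], the first condition says that [w] is an eigenvector of [h], hence of
    [g]. Otherwise a suitable [h] exists, and is unique, exactly when [g • w] is not parallel to
    [v]. *)
Lemma eigvec_conv_vec (g : {'GL_2[F]}) (w : V) : w != 0 ->
  (\sum_(v : V | v != 0%R) \sum_(h in SL2 p) ((cross (h • v) v == 0%R) && (h • w == g • w)))%N =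
  (2 * p * (p - 1) * (cross (g • w) w == 0%R) + (p - 1) ^ 2 * (cross (g • w) w != 0%R))%N.
Proof.
move=> w0; rewrite (bigID (fun v => cross v w == 0)) /=.
have -> : (\sum_(v : V | (v != 0%R) && (cross v w == 0%R))
    \sum_(h in SL2 p) ((cross (h • v) v == 0%R) && (h • w == g • w)) =
    (p - 1) * (p * (cross (g • w) w == 0%R)))%N.
  rewrite -(card_line w0) -sum_nat_const; apply: eq_bigr => v /andP[v0 /eqP].
  move=> /(cross_eq0P w0) [c vE].
  have c0 : c != 0 by apply: contraNneq v0 => c0; rewrite vE c0 scale0r.
  transitivity ((\sum_(h in SL2 p) (h • w == g • w)) * (cross (g • w) w == 0%R))%N; last first.
    by rewrite (sum_SL2_vec w0 (mulmx_GL_neq0 g w0)).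
  rewrite big_distrl; apply: eq_bigr => h _ /=.
  have -> : (cross (h • v) v == 0) = (cross (h • w) w == 0).
    rewrite vE -scalemxAr (_ : cross _ _ = c ^+ 2 * cross (h • w) w).
      by rewrite mulf_eq0 expf_eq0 /= (negbTE c0).
    by rewrite /cross !mxE; ring.
  by case: (h • w =P g • w) => [->|]; rewrite ?andbT ?andbF ?mul1n.
have -> : (\sum_(v : V | (v != 0%R) && (cross v w != 0%R))
    \sum_(h in SL2 p) ((cross (h • v) v == 0%R) && (h • w == g • w)) =
    #|[pred v : V | (cross v w != 0%R) && (cross v (g • w) != 0%R)]|)%N.
  rewrite -sum_nat_of_bool; apply: eq_big => [v|v /andP[v0 vw]].
    by case: (eqVneq v 0) => [->|//]; rewrite /cross !mxE !mul0r subrr eqxx.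
  (* [cross (h • v) v = 0] iff [h • v = c v] for a, necessarily unique, [c]. *)
  transitivity (\sum_(c : F) \sum_(h in SL2 p) ((h • v == c *: v) && (h • w == g • w)))%N.
    rewrite exchange_big; apply: eq_bigr => h _ /=; case: eqP => [/(cross_eq0P v0)[c hv]|hv].
      rewrite hv (bigD1 c) //= eqxx big1 ?addn0 // => c' cc'.
      apply/eqP; rewrite eqb0; apply/negP => /andP[/eqP e _].
      have /eqP : (c' - c) *: v = 0 by rewrite scalerBl e subrr.
      by rewrite scaler_eq0 subr_eq0 (negbTE cc') (negbTE v0).
    rewrite big1 // => c _; apply/eqP; rewrite eqb0; apply/negP => /andP[/eqP e _].
    by apply: hv; rewrite e /cross !mxE; ring.
  under eq_bigr => c _ do rewrite sum_SL2_pair // crossZl.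
  case: (eqVneq (cross v (g • w)) 0) => [-> | gz].
    by rewrite big1 // => c _; rewrite mulr0 (negbTE vw).
  rewrite (bigD1 (cross v w / cross v (g • w))) //= mulfVK // eqxx big1 // => c.
  move=> cn; apply/eqP; rewrite eqb0; apply: contra cn => /eqP ->.
  by rewrite mulfK.
case: (eqVneq (cross (g • w) w) 0) => z.
  have [c gw] := cross_eq0P w0 z.
  have c0 : c != 0 by apply: contraNneq (mulmx_GL_neq0 g w0) => c0; rewrite gw c0 scale0r.
  rewrite (eq_card (B := [pred v : V | cross v w != 0])); last first.
    move=> v; rewrite !inE gw (crossC v (_ *: _)) crossZl oppr_eq0 mulf_eq0 (negbTE c0).
    by rewrite (crossC w) oppr_eq0 andbb.
  rewrite card_cross_neq0 // card_F !muln1 muln0 addn0.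
  by have := prime_gt0 p_pr; nia.
(* From the [p ^ 2 - p] vectors not parallel to [w], remove the [p - 1] nonzero multiples of
   [g • w]. *)
rewrite !muln0 !add0n muln1.
have := card_cross_neq0 w0; rewrite card_F.
rewrite -(cardID [pred v : V | cross v (g • w) != 0]).
rewrite (_ : #|[predI _ & _]| =
  #|[pred v : V | (cross v w != 0) && (cross v (g • w) != 0)]|); last first.
  by apply: eq_card => v; rewrite !inE andbC.
rewrite (_ : #|[predD _ & _]| = (p - 1)%N); last first.
  rewrite -(card_line (mulmx_GL_neq0 g w0)); apply: eq_card => v; rewrite !inE negbK andbC.
  case: (cross v (g • w) =P 0); rewrite ?andbF // !andbT => vz.
  apply/idP/idP; first by apply: contraNneq => ->; rewrite /cross !mxE !mul0r subrr.
  apply: contraNneq => vw; apply/eqP; apply: (cross_eq0_both z); first by rewrite crossC vz oppr0.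
  by rewrite crossC vw oppr0.
by have := prime_gt0 p_pr; nia.
Qed.

Lemma eigvec_conv (g : {'GL_2[F]}) :
  (\sum_(h in SL2 p) eigvec (X h) * fixvec (X (h^-1 * g)%g) =
  (p - 1) * (p + 1) * eigvec (X g) + (p - 1) ^ 2 * (p ^ 2 - 1))%N.
Proof.
have -> : (\sum_(h in SL2 p) eigvec (X h) * fixvec (X (h^-1 * g)%g) =
  \sum_(w : V | w != 0%R)
    (2 * p * (p - 1) * (cross (g • w) w == 0%R) + (p - 1) ^ 2 * (cross (g • w) w != 0%R)))%N.
  under [RHS]eq_bigr => w w0 do rewrite -eigvec_conv_vec //.
  under eq_bigr => h _.
    rewrite fixvec_divl big_distrlr exchange_big /=.
    under eq_bigr => w _ do under eq_bigr => v _ do rewrite mulnb.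
    over.
  by rewrite exchange_big; apply: eq_bigr => w _; rewrite exchange_big.
(* Both indicators now carry the coefficient [(p - 1) ^ 2], and they add up to 1 at each [w]. *)
have -> : (2 * p * (p - 1) = (p - 1) * (p + 1) + (p - 1) ^ 2)%N.
  by have := prime_gt0 p_pr; nia.
rewrite -card_neq0_p -sum1_card !big_distrr -big_split; apply: eq_bigr => w _ /=.
by case: (_ == _); rewrite /= ?muln0 ?muln1 ?addn0 ?add0n.
Qed.

(** At trace 2 and away from the identity, [g - 1] is singular and nonzero, so its kernel is a line.
    The last term raises the count to [p ^ 2 - 1] at the identity. *)
Lemma fixvecE (g : {'GL_2[F]}) : g \in SL2 p ->
  fixvec (X g) = ((p - 1) * (\tr (X g) == 2%:R) + p * (p - 1) * (g == 1%g))%N.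
Proof.
move=> gS; case: (eqVneq g 1%g) => [->|g1].
  rewrite GL_1E mxtrace_scalar eqxx !muln1 /fixvec.
  under eq_bigr => v _ do rewrite [_ *m v]mul1mx eqxx.
  by rewrite sum1_card card_neq0_p; have := prime_gt0 p_pr; nia.
rewrite muln0 addn0 /fixvec sum_nat_of_bool.
have [N NB] : exists N : 'M[F]_2, N = X g - 1%:M by exists (X g - 1%:M).
have NE (v : V) : (g • v == v) = (N *m v == 0) by rewrite NB mulmxBl mul1mx subr_eq0.
have dN : N 0 0 * N 1 1 - N 0 1 * N 1 0 = 2%:R - \tr (X g).
  have := SL2_det gS; rewrite det22 tr22 NB !mxE /= !mulr0n !mulr1n => e.
  transitivity ((X g) 0 0 * (X g) 1 1 - (X g) 0 1 * (X g) 1 0 + 1 -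
    ((X g) 0 0 + (X g) 1 1)); first by ring.
  by rewrite e.
(* [r i] is the [i]-th row of [N] turned by a right angle: [N v = 0] iff [v] is
   parallel to both. *)
pose r i : V := \col_k (if k == 0 then - N i 1 else N i 0).
have rE i v : (N *m v) i 0 = cross v (r i).
  by rewrite mul22E /cross !mxE /=; ring.
have rr : cross (r 0) (r 1) = 2%:R - \tr (X g).
  by rewrite -dN /cross !mxE /=; ring.
have kerN v : (g • v == v) = (cross v (r 0) == 0) && (cross v (r 1) == 0).
  rewrite NE; apply/eqP/andP => [Nv|[/eqP e0 /eqP e1]].
    by rewrite -!rE Nv !mxE.
  by apply: cV2P; rewrite rE mxE.
case: eqP => [trg | /eqP trg]; last first.
  rewrite muln0; apply: eq_card0 => v; rewrite !inE kerN;
  apply/negP => /and3P[/negP v0 /eqP e0 /eqP e1].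
  apply: v0; apply/eqP; apply: (@cross_eq0_both _ (r 0) (r 1)).
  - by rewrite rr subr_eq0 eq_sym.
  - by rewrite crossC e0 oppr0.
  - by rewrite crossC e1 oppr0.
rewrite trg subrr in rr; rewrite muln1.
have rn0 : (r 0 != 0) || (r 1 != 0).
  case: (eqVneq (r 0) 0) => r0 //=; apply: contraNneq g1 => r1.
  have Nz i : r i = 0 -> forall j, N i j = 0.
    move=> /matrixP ri j; have := ri 0 0; have := ri 1 0; rewrite !mxE /= => n0 /eqP.
    rewrite oppr_eq0 => /eqP n1.
    by case: j => [[|[|//]]] hj; [rewrite -[RHS]n0 | rewrite -[RHS]n1];
      congr (N i _); apply: val_inj.
  have N0 : N = 0.
    apply/matrixP => k j; rewrite [RHS]mxE; apply: Nz.
    by case: k => [[|[|//]]] hk; [rewrite -r0 | rewrite -r1]; congr r; apply: val_inj.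
  by apply/eqP/val_inj/subr0_eq; rewrite -[LHS]NB.
(* The two rows are parallel, so a nonzero one alone cuts out the kernel. *)
have par (v a b : V) : a != 0 -> cross b a = 0 -> cross v a = 0 -> cross v b = 0.
  move=> a0 /(cross_eq0P a0)[k ->] va.
  by rewrite crossC crossZl crossC va oppr0 mulr0 oppr0.
case/orP: rn0 => ri; rewrite -(card_line ri); apply: eq_card => v;
  rewrite !inE kerN; case: (v != 0) => //=.
  apply/andP/eqP => [[/eqP ->]//|e]; rewrite e eqxx; split=> //; apply/eqP.
  by apply: (par _ (r 0)) => //; rewrite crossC rr oppr0.
apply/andP/eqP => [[_ /eqP ->]//|e]; rewrite e eqxx; split=> //; apply/eqP.
by apply: (par _ (r 1)).
Qed.

Lemma eigvec1 : eigvec 1%:M = (p ^ 2 - 1)%N.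
Proof.
rewrite /eigvec; under eq_bigr => v _ do rewrite mul1mx crossvv eqxx.
by rewrite sum1_card card_neq0_p.
Qed.

End SL2.

(** * Convolution matrices on a finite group *)

Definition conv_mx (R : nzRingType) (gT : finGroupType) (G : {set gT}) (f : gT -> R) :
    'M[R]_#|G| :=
  \matrix_(i, j) f ((enum_val i)^-1 * enum_val j)%g.

Section Conv.
Variables (R : nzRingType) (gT : finGroupType) (G : {group gT}).
Implicit Types f : gT -> R.

Lemma eq_conv_mx f1 f2 : {in G, f1 =1 f2} -> conv_mx G f1 = conv_mx G f2.
Proof.
move=> e; apply/matrixP => i j; rewrite !mxE; apply: e.
by rewrite groupM ?groupV ?enum_valP.
Qed.

(** Substitute for [h] the quotient of the [k]-th element of [G] by the [i]-th; it runs over [G] as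
    [k] varies. *)
Lemma conv_mxM f1 f2 :
  conv_mx G f1 *m conv_mx G f2 =
  conv_mx G (fun g => \sum_(h in G) f1 h * f2 (h^-1 * g)%g).
Proof.
apply/matrixP => i j; rewrite !mxE.
rewrite (reindex_inj (mulgI (enum_val i)^-1%g)) /=.
rewrite (eq_bigl (mem G)); last by move=> h; rewrite /= groupMl ?groupV ?enum_valP.
rewrite [RHS]big_enum_val; apply: eq_bigr => k _; rewrite !mxE.
by rewrite invMg invgK -!mulgA mulKVg.
Qed.

Lemma trace_conv_mx f : \tr (conv_mx G f) = #|G|%:R * f 1%g.
Proof.
rewrite /mxtrace; under eq_bigr => i _ do rewrite mxE mulVg.
by rewrite sumr_const card_ord mulr_natl.
Qed.

End Conv.

(** * The matrices D, R, J and the Cayley graph *)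

Lemma SL2_group_set p : group_set (SL2 p).
Proof.
apply/group_setP; split; first by rewrite inE GL_1E det1.
by move=> g h; rewrite !inE GL_ME det_mulmx => /eqP-> /eqP->; rewrite mulr1.
Qed.
Canonical SL2_group p := Group (SL2_group_set p).

Section Spectrum.
Variable p : nat.
Hypothesis p_pr : prime p.
Local Notation X h := (GLval h : 'M['F_p]_2).

(** Summing [fixvecE] and comparing with [sum_fixvec] gives [(p - 1) * #|U| + p * (p - 1) = p * (p ^
    2 - 1)] for the set [U] of trace 2, the complement of [Tset p]. *)
Lemma card_Tset : #|Tset p| = (#|SL2 p| - p ^ 2)%N.
Proof.
pose U := [set g in SL2 p | \tr (X g) == 2%:R].
have cU : (#|U| = p ^ 2)%N.
  have := sum_fixvec p_pr; under eq_bigr => g gS do rewrite fixvecE //.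
  rewrite big_split -!big_distrr /= !sum_nat_of_bool.
  rewrite (_ : #|[pred g | (g \in SL2 p) && (\tr (X g) == 2%:R)]| = #|U|); last first.
    by apply: eq_card => g; rewrite !inE.
  rewrite (_ : #|[pred _ | _ && (_ == 1%g)]| = 1%N); last first.
    apply: etrans (card1 (1%g : {'GL_2['F_p]})); apply: eq_card => g.
    rewrite -[LHS]/((g \in SL2 p) && (g == 1%g)) -[RHS]/(g == 1%g) andb_idl // => /eqP ->.
    exact: (group1 (SL2_group p)).
  move=> e; apply/eqP; have q0 : (0 < p - 1)%N by rewrite subn_gt0 prime_gt1.
  rewrite -(eqn_pmul2l q0); apply/eqP; move: e.
  suff -> : (p * (p ^ 2 - 1) = (p - 1) * p ^ 2 + p * (p - 1) * 1)%N by move/addIn.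
  by case: (p) p_pr => // q _; rewrite subn1 -mulnn mulnS addSn subn1 /=; nia.
rewrite -cU -(cardsID U (SL2 p)) (setIidPr _); last by apply/subsetP => g /[!inE] /andP[].
by rewrite addKn; apply: eq_card => g; rewrite !inE; case: (\det _ == _); rewrite ?andbT ?andbF.
Qed.

(* The number of lines fixed pointwise by [g], in closed form; see [fixlinesE]. *)
Definition fixlines (g : {'GL_2['F_p]}) : rat := (\tr (X g) == 2%:R)%:R + p%:R * (g == 1%g)%:R.
Definition eigenlines (g : {'GL_2['F_p]}) : rat := (eigvec (X g))%:R / (p%:R - 1).

Let x : rat := p%:R.

Lemma x_gt1 : 1 < x. Proof. by rewrite ltr1n prime_gt1. Qed.

Lemma x1_neq0 : x - 1 != 0. Proof. by rewrite subr_eq0 gt_eqF ?x_gt1. Qed.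

Lemma natr_p1 : (p - 1)%N%:R = x - 1 :> rat.
Proof. by rewrite natrB // prime_gt0. Qed.

Lemma natr_p21 : (p ^ 2 - 1)%N%:R = x ^+ 2 - 1 :> rat.
Proof. by rewrite natrB ?natrX // expn_gt0 prime_gt0. Qed.

Lemma fixlinesE g : g \in SL2 p -> fixlines g = (fixvec (X g))%:R / (x - 1).
Proof.
move=> gS; rewrite fixvecE // natrD !natrM natr_p1 /fixlines -/x.
by field; exact: x1_neq0.
Qed.

Lemma eigvecE (g : {'GL_2['F_p]}) : (eigvec (X g))%:R = eigenlines g * (x - 1).
Proof. by rewrite /eigenlines divfK ?x1_neq0. Qed.

Local Notation D := (conv_mx (SL2 p) fixlines).
Local Notation R := (conv_mx (SL2 p) eigenlines).
Local Notation J := (conv_mx (SL2 p) (fun=> 1 : rat)).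

Lemma sum_mul_fixlines (f : {'GL_2['F_p]} -> rat) g : g \in SL2 p ->
  \sum_(h in SL2 p) f h * fixlines (h^-1 * g)%g =
  (\sum_(h in SL2 p) f h * (fixvec (X (h^-1 * g)%g))%:R) / (x - 1).
Proof.
move=> gS; rewrite mulr_suml; apply: eq_bigr => h hS.
by rewrite fixlinesE ?mulrA // (groupM (G := SL2_group p)) ?groupV.
Qed.

(** This is [fixvec_conv] divided by [(p - 1) ^ 2]. *)
Lemma mul_fixlines_fixlines : D *m D = (2 * x) *: D + (x + 1) *: J - R.
Proof.
rewrite (conv_mxM (SL2_group p)).
rewrite (eq_conv_mx (G := SL2_group p)
  (f2 := fun g => 2 * x * fixlines g + (x + 1) * 1 - eigenlines g)).
  by apply/matrixP => i j; rewrite !mxE.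
move=> g gS /=; rewrite sum_mul_fixlines //.
under eq_bigr => h hS do rewrite fixlinesE // mulrAC -natrM.
rewrite -mulr_suml -natr_sum.
have /(congr1 (fun m => m%:R : rat)) := fixvec_conv p_pr g.
rewrite !natrD !natrM natr_p1 natr_p21 -/x eigvecE.
move/(canRL (addrK _)) => ->; rewrite fixlinesE //.
by field; exact: x1_neq0.
Qed.

Lemma mul_eigenlines_fixlines : R *m D = (x + 1) *: R + (x ^+ 2 - 1) *: J.
Proof.
rewrite (conv_mxM (SL2_group p)).
rewrite (eq_conv_mx (G := SL2_group p) (f2 := fun g => (x + 1) * eigenlines g + (x ^+ 2 - 1) * 1)).
  by apply/matrixP => i j; rewrite !mxE.
move=> g gS /=; rewrite sum_mul_fixlines //.
under eq_bigr => h hS do rewrite /eigenlines -/x mulrAC -natrM.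
rewrite -mulr_suml -natr_sum.
rewrite eigvec_conv // !natrD !natrM natr_p1 natr_p21 -/x eigvecE.
by field; exact: x1_neq0.
Qed.

Lemma mul_ones_fixlines : J *m D = (x * (x + 1)) *: J.
Proof.
rewrite (conv_mxM (SL2_group p)).
rewrite (eq_conv_mx (G := SL2_group p) (f2 := fun g => x * (x + 1) * 1)).
  by apply/matrixP => i j; rewrite !mxE.
move=> g gS /=; rewrite sum_mul_fixlines //.
under eq_bigr => h hS do rewrite mul1r fixvec_divl.
rewrite -natr_sum exchange_big /=; under eq_bigr => w w0 do rewrite sum_SL2_vec ?mulmx_GL_neq0 //.
rewrite sum_nat_const card_neq0_p // natrM natr_p21.
by field; exact: x1_neq0.
Qed.

Lemma mul_fixlines_ones : D *m J = (x * (x + 1)) *: J.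
Proof.
rewrite (conv_mxM (SL2_group p)).
rewrite (eq_conv_mx (G := SL2_group p) (f2 := fun g => x * (x + 1) * 1)).
  by apply/matrixP => i j; rewrite !mxE.
move=> g gS /=.
under eq_bigr => h hS do rewrite mulr1 fixlinesE //.
rewrite -mulr_suml -natr_sum sum_fixvec // natrM natr_p21.
by field; exact: x1_neq0.
Qed.

(** The first product is [(x + 1) *: J - R]. Multiplying it by the last factor cancels R, by
    [mul_eigenlines_fixlines], and leaves a multiple of J. *)
Lemma fixlines_annihilated :
  D *m (D - (2 * p)%:R%:M) *m (D - (p + 1)%:R%:M) = #|SL2 p|%:R *: J.
Proof.
rewrite [D *m (D - _)]mulmxBr mul_fixlines_fixlines mul_mx_scalar natrM -/x.
rewrite (_ : _ - _ = (x + 1) *: J - R); last first.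
  by apply/matrixP => i j; rewrite !mxE; ring.
rewrite mulmxBr mulmxBl -scalemxAl mul_ones_fixlines mul_eigenlines_fixlines mul_mx_scalar.
have -> : #|SL2 p|%:R = x * (x ^+ 2 - 1) :> rat by rewrite card_SL2 // natrM natr_p21.
rewrite natrD -/x.
by apply/matrixP => i j; rewrite !mxE; ring.
Qed.

Lemma fixlines1 : fixlines 1%g = x + 1.
Proof. by rewrite /fixlines GL_1E mxtrace_scalar !eqxx mulr1 addrC. Qed.

Lemma eigenlines1 : eigenlines 1%g = x + 1.
Proof.
rewrite /eigenlines GL_1E eigvec1 // natr_p21 -/x; by field; exact: x1_neq0.
Qed.

Lemma char_poly_rat :
  char_poly (J + x%:M - D) =
    (('X - ((p * (p ^ 2 - 1) - p ^ 2)%N)%:R%:P) *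
     ('X - (p%:R)%:P) ^+ (p * (p - 1) ^ 2 %/ 2) *
     ('X - (-1)%:P) ^+ (p ^ 2) *
     ('X - (- p%:R)%:P) ^+ ((p - 2) * (p + 1) ^ 2 %/ 2)).
Proof.
apply: char_poly_annihilated; rewrite ?prime_gt1 //.
- exact: card_SL2.
- exact: fixlines_annihilated.
- by rewrite mul_fixlines_ones natrM natrD.
- by rewrite (trace_conv_mx (SL2_group p)) mulr1.
- by rewrite (trace_conv_mx (SL2_group p)) fixlines1 natrM natrD.
(* The traces of [(x + 1) *: J] and R cancel, since R takes the value [x + 1] at the identity. *)
- rewrite mul_fixlines_fixlines !(raddfD, raddfB, raddfN) /= !mxtraceZ
    !(trace_conv_mx (SL2_group p)) /=.
  rewrite fixlines1 eigenlines1 natrM natrM natrM natrD -/x; ring.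
Qed.

(** The diagonal [x] cancels the extra [p] of [fixlines] at the identity, leaving 1 minus the
    indicator of trace 2. *)
Lemma cayley_adjE :
  map_mx intr (cayley_adj (SL2 p) (Tset p)) = J + x%:M - D.
Proof.
apply/matrixP => i j; rewrite !mxE /fixlines -/x.
set g := (_ * _)%g.
have gS : g \in SL2 p by rewrite (groupM (G := SL2_group p)) ?groupV ?enum_valP.
have -> : (g == 1%g) = (i == j).
  by rewrite -eq_mulVg1 (inj_eq enum_val_inj).
rewrite [g \in Tset p]inE gS /=.
by case: (\tr _ == _); case: (i == j) => /=; ring.
Qed.

End Spectrum.

Theorem theorem4 (p : nat) (hp : prime p) :
  #|Tset p| = (#|SL2 p| - p ^ 2)%N /\
  char_poly (cayley_adj (SL2 p) (Tset p)) =
    (('X - ((p * (p ^ 2 - 1) - p ^ 2)%N)%:Z%:P) *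
     ('X - (p%:Z)%:P) ^+ (p * (p - 1) ^ 2 %/ 2) *
     ('X - (-1 : int)%:P) ^+ (p ^ 2) *
     ('X - (- p%:Z)%:P) ^+ ((p - 2) * (p + 1) ^ 2 %/ 2))%R.
Proof.
split; first exact: card_Tset.
(* The diagonalization takes place over the rationals; injectivity of [intr] brings the identity
   back to integer polynomials. *)
apply: (@map_inj_poly _ rat intr); [exact: intr_inj | exact: mulr0z |].
rewrite map_char_poly cayley_adjE // char_poly_rat //.
by rewrite !(rmorphM, rmorphXn, rmorphB) /= !map_polyX !map_polyC /= !mulrNz.
Qed.
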